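(* Let $q$ be a prime power and $m\ge 2$ an integer, and write $N=\sum_{j=1}^{m}q^{j}$. Suppose the maximal size of a blocking set in $PG_{m}(q)$ is $k$. Then the Turán density of the $(q+1)$-uniform hypergraph $PG_{m}(q)$ satisfies \[\pi(PG_{m}(q))\ge\max\Big\{(q+1)!\sum_{i=1}^{q}\binom{N-k}{q+1-i}\frac{(1-(N-k)\alpha)^{i}}{i!}\alpha^{q-i+1}:\ 0\le\alpha\le\frac{1}{N-k}\Big\}.\]
   Context: $PG_{m}(q)$ is regarded as the $(q+1)$-uniform hypergraph whose vertices are the one-dimensional subspaces of $\mathbb{F}_q^{m+1}$ (the points) and whose edges are the sets of points contained in a two-dimensional subspace (the lines); it has $\sum_{i=0}^m q^i$ vertices. A blocking set in $PG_m(q)$ is a set $\mathcal{B}$ of points with $1\le|\mathcal{B}\cap\ell|\le q$ for every line $\ell$. For an $r$-uniform hypergraph $\mathcal{H}$, $\mathrm{ex}(n,\mathcal{H})$ is the maximum number of edges in an $n$-vertex $r$-uniform hypergraph containing no subhypergraph isomorphic to $\mathcal{H}$, and the Turán density is $\pi(\mathcal{H})=\lim_{n\to\infty}\mathrm{ex}(n,\mathcal{H})/\binom{n}{r}$. *)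

(* Defs.v *)
From HB Require Import structures.
From mathcomp Require Import all_boot all_order all_algebra.
From mathcomp Require Import all_classical all_reals all_analysis.

Set Implicit Arguments.
Unset Strict Implicit.
Unset Printing Implicit Defensive.

Import Order.TTheory GRing.Theory Num.Theory.
Import numFieldNormedType.Exports.

Local Open Scope ring_scope.

(* A hypergraph with vertex type T is identified with its set of edges,
   an element of {set {set T}}. *)
Definition uniform (r : nat) (T : finType) (G : {set {set T}}) : bool :=
  [forall e in G, #|e| == r].

(* G has a subhypergraph isomorphic to H; subhypergraphs need not be induced. *)
Definition contains_copy (T V : finType) (H : {set {set T}})
    (G : {set {set V}}) : bool :=
  [exists f : {ffun T -> V},
    injectiveb f && [forall e in H, [set f x | x in e] \in G]].

Definition ex (r n : nat) (T : finType) (H : {set {set T}}) : nat :=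
  (\max_(G : {set {set 'I_n}} | uniform r G && ~~ contains_copy H G) #|G|)%N.

Definition turan_density (R : realType) (r : nat) (T : finType)
    (H : {set {set T}}) : R :=
  limn (fun n : nat => (ex r n H)%:R / 'C(n, r)%:R : R).

(* {vspace vT} is a subtype of a matrix type only inside VectorInternalTheory. *)
Section FiniteVspace.
Import VectorInternalTheory.
Variables (F : finFieldType) (vT : vectType F).
HB.instance Definition _ := [Finite of {vspace vT} by <:].
End FiniteVspace.

Definition PG_point (F : finFieldType) (m : nat) : finType :=
  {U : {vspace 'rV[F]_m.+1} | \dim U == 1%N}.

Definition PG (F : finFieldType) (m : nat) : {set {set PG_point F m}} :=
  [set [set p : PG_point F m | (val p <= W)%VS]
     | W : {vspace 'rV[F]_m.+1} & \dim W == 2%N].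

Definition blocking_set (F : finFieldType) (m : nat)
    (B : {set PG_point F m}) : bool :=
  [forall l in PG F m, (1 <= #|B :&: l| <= #|F|)%N].

Definition max_blocking_size (F : finFieldType) (m k : nat) : Prop :=
  (exists2 B : {set PG_point F m}, blocking_set B & #|B| = k) /\
  (forall B : {set PG_point F m}, blocking_set B -> (#|B| <= k)%N).

Definition is_maximum (R : realType) (S : set R) (M : R) : Prop :=
  S M /\ ubound S M.

(* Main.v *)
(* For 0 <= alpha <= 1/n, where n = N - k, colour each of M vertices
   independently with one of n colours, each of probability alpha, or leave it
   uncoloured. Take as edges the (q+1)-sets that contain both coloured and
   uncoloured vertices and whose coloured vertices have distinct colours. The
   expected number of edges is 'C(M, q+1) times the expression to be maximized,
   so some colouring has at least that many edges, for every M. (That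
   ex(M, H) / 'C(M, r) is nonincreasing makes the density a limit.) A copy of
   PG_m(q) would make the uncoloured points a blocking set; these are at most k,
   so more than n of the N + 1 points are coloured, two of them have the same
   colour, and no edge can contain both, although they lie on a line. *)
Require Import Defs.
From HB Require Import structures.
From mathcomp Require Import all_boot all_order all_algebra.
From mathcomp Require Import all_classical all_reals all_analysis.
From mathcomp Require Import ring.

Set Implicit Arguments.
Unset Strict Implicit.
Unset Printing Implicit Defensive.

Import Order.TTheory GRing.Theory Num.Theory.
Import numFieldNormedType.Exports.

Local Open Scope classical_set_scope.
Local Open Scope ring_scope.

(** * Turán numbers and their limit *)

Lemma contains_copy_preimset (T V W : finType) (H : {set {set T}})
    (G : {set {set W}}) (g : V -> W) : injective g ->
  contains_copy H [set e : {set V} | g @: e \in G]%SET -> contains_copy H G.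
Proof.
move=> g_inj /existsP[f /andP[/injectiveP f_inj /forall_inP fH]].
apply/existsP; exists [ffun x => g (f x)]; apply/andP; split.
  by apply/injectiveP => x y; rewrite !ffunE => /g_inj/f_inj.
apply/forall_inP => e /fH; rewrite inE -imset_comp.
by under [in X in _ -> is_true (X \in _)]eq_imset do rewrite ffunE.
Qed.

Lemma leq_card_ex (r n : nat) (T : finType) (H : {set {set T}})
    (G : {set {set 'I_n}}) :
  uniform r G -> ~~ contains_copy H G -> (#|G| <= ex r n H)%N.
Proof.
move=> rG HG; rewrite /ex.
by rewrite (bigD1 G) ?rG ?HG //= leq_maxl.
Qed.

(* Deleting each vertex in turn keeps every edge n.+1 - r times. *)
Lemma ex_averaging (r n : nat) (T : finType) (H : {set {set T}}) :
  ((n.+1 - r) * ex r n.+1 H <= n.+1 * ex r n H)%N.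
Proof.
rewrite {1}/ex; elim/big_ind: _ => [|x y xP yP|G /andP[rG HG]].
- by rewrite muln0.
- by rewrite maxnMr geq_max xP.
pose l (v : 'I_n.+1) : 'I_n -> 'I_n.+1 := lift v.
have l_inj v : injective (l v) by exact: lift_inj.
pose del v := [set e : {set 'I_n} | l v @: e \in G]%SET.
have del_ex v : (#|del v| <= ex r n H)%N.
  apply: leq_card_ex.
    apply/forall_inP => e; rewrite inE => /(forall_inP rG).
    by rewrite card_imset.
  by apply: contra HG; exact: contains_copy_preimset.
have card_del v : #|del v| = #|[set e in G | v \notin e]%SET|.
  rewrite -(card_imset _ (imset_inj (@l_inj v))); apply: eq_card => e.
  apply/imsetP/setIdP => [[e' ]|[eG ve]].
    rewrite inE => e'G ->; split=> //; apply/negP => /imsetP[j _] /eqP.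
    by rewrite (negPf (neq_lift _ _)).
  have le : l v @: [set j | l v j \in e]%SET = e; last first.
    by exists [set j | l v j \in e]%SET; rewrite ?inE le.
  apply/setP => w; apply/imsetP/idP => [[j]|we]; first by rewrite inE => ? ->.
  case: (unliftP v w) => [j wj|wv]; last by rewrite -wv we in ve.
  by exists j; rewrite ?inE /l -?wj.
have := leq_sum (index_enum _) (fun v (_ : v \in predT) => del_ex v).
rewrite sum_nat_const card_ord; apply: leq_trans.
under eq_bigr => v _ do rewrite card_del -sum1dep_card big_mkcondr /=.
rewrite exchange_big /= mulnC -sum_nat_const; apply: leq_sum => e eG.
rewrite -big_mkcond /= sum1dep_card.
have <- := eqP (forall_inP rG _ eG); rewrite leq_subLR.
have /= := cardC (mem e); rewrite card_ord => {1}<-; rewrite leq_add2l.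
by apply/eq_leq/eq_card => v; rewrite !inE.
Qed.

(** The limit exists because the ratios are nonnegative and, from [n = r] on, nonincreasing. Below
    [r] the binomial vanishes and the ratio is 0 by convention, so monotonicity holds only
    eventually. *)
Lemma turan_density_ge (R : realType) (r : nat) (T : finType)
    (H : {set {set T}}) (x : R) :
  (forall n, (r <= n)%N -> x * 'C(n, r)%:R <= (ex r n H)%:R) ->
  x <= turan_density R r H.
Proof.
move=> xP; apply: limr_ge.
  apply: (@near_nonincreasing_is_cvgn _ _ 0); last first.
    by apply: nearW => n; rewrite divr_ge0.
  near=> n => m nm.
  have rn : (r <= n)%N by near: n; exact: nbhs_infty_ge.
  elim: m nm => [|m IHm]; first by rewrite leqn0 => /eqP->.
  rewrite leq_eqVlt => /predU1P[->//|]; rewrite ltnS => nm.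
  apply: le_trans (IHm nm); have rm := leq_trans rn nm.
  rewrite ler_pdivrMr ?ltr0n ?bin_gt0 ?(leq_trans rm)// mulrAC.
  rewrite ler_pdivlMr ?ltr0n ?bin_gt0// -!natrM ler_nat.
  (* The factor [m.+1 - r] turns ['C(m.+1, r)] into [m.+1 * 'C(m, r)], which leaves the averaging
     inequality times ['C(m, r)]. *)
  rewrite -(@leq_pmul2l (m.+1 - r)) ?subn_gt0//.
  rewrite [leqRHS]mulnCA -mul_bin_down /= mulnA [leqRHS]mulnA.
  by rewrite leq_mul2r (mulnC (ex r m H)) ex_averaging orbT.
near=> n; rewrite ler_pdivlMr ?xP//; last rewrite ltr0n bin_gt0.
  by near: n; exact: nbhs_infty_ge.
by near: n; exact: nbhs_infty_ge.
Unshelve. all: by end_near.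
Qed.

(** * Random colourings and the expected number of edges *)

(** Marginals of a product measure: coordinates off the image of [x] sum out to 1. With [x] the
    inclusion of an edge, only the colours on that edge matter. *)
Lemma sum_prod_marginal (R : comNzRingType) (T U C : finType) (w : C -> R)
    (x : U -> T) (Phi : {ffun U -> C} -> R) :
  \sum_y w y = 1 -> injective x ->
  \sum_(c : {ffun T -> C}) (\prod_v w (c v)) * Phi [ffun u => c (x u)] =
  \sum_(g : {ffun U -> C}) (\prod_u w (g u)) * Phi g.
Proof.
move=> w1 x_inj.
pose p (c : {ffun T -> C}) : {ffun U -> C} := [ffun u => c (x u)].
rewrite (partition_big p xpredT) //=; apply: eq_bigr => g _.
rewrite (eq_bigr (fun c : {ffun T -> C} => \prod_v w (c v) * Phi g)); last first.
  by move=> c /eqP <-.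
rewrite -big_distrl /=; congr (_ * _).
(* [Q v] is the set of colours allowed at [v]: only [g u] if [v = x u], and every colour off the
   image. The colourings that restrict to [g] thus form a product, and their total weight
   factors. *)
pose Q v := [pred y | [forall u, (x u == v) ==> (g u == y)]].
rewrite (eq_bigl (mem (family Q))); last first.
  move=> c; apply/eqP/familyP => [pc v|cQ].
    by apply/forallP => u; apply/implyP => /eqP <-; rewrite -pc ffunE.
  apply/ffunP => u; rewrite ffunE.
  by have /forallP/(_ u) := cQ (x u); rewrite eqxx => /eqP.
rewrite -(bigA_distr_big_dep _ (fun=> w)) (bigID (mem (x @: [set: U]%SET))) /=.
rewrite [X in _ * X]big1 ?mulr1 => [|v vx]; last first.
  rewrite -[RHS]w1; apply: eq_bigl => y; apply/forallP => u; apply/implyP.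
  have xu : x u \in x @: [set: U]%SET by exact: imset_f.
  by move=> /eqP xuv; rewrite xuv (negPf vx) in xu.
rewrite big_imset /=; last exact: (in2W x_inj).
apply: eq_big => u; first by rewrite inE.
move=> _; rewrite (big_pred1 (g u))// => y; rewrite inE.
apply/forallP/eqP => [/(_ u)|-> u'].
  by rewrite eqxx => /eqP.
by apply/implyP => /eqP/x_inj ->.
Qed.

(* [Some j] is the j-th colour, [None] means uncoloured. *)
Definition rainbow (U : finType) (n : nat) (g : {ffun U -> option 'I_n}) :=
  [&& [exists u, g u == None], [exists u, g u != None] &
      [forall u, forall v, (g u != None) && (g u == g v) ==> (u == v)]].

(** Each injection of the complement of [S] into the colours, extended by [None] on [S], is such a
    colouring. *)
Lemma card_rainbow (U : finType) (n : nat) (S : {set U}) :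
  (0 < #|S| < #|U|)%N ->
  (n ^_ (#|U| - #|S|) <= #|[set g : {ffun U -> option 'I_n} |
     rainbow g && ([set u | g u == None] == S)]%SET|)%N.
Proof.
move=> /andP[S0 SU]; pose D : finType := {u | u \in (~: S)%SET}.
have cardD : #|D| = (#|U| - #|S|)%N.
  rewrite card_sig -[in RHS](finset.setCK S) -cardsCs.
  by apply: eq_card => u; rewrite inE.
rewrite -cardD.
pose ext (h : {ffun D -> 'I_n}) : {ffun U -> option 'I_n} :=
  [ffun u => omap h (insub u)].
have extS h u : (u \in S) = (ext h u == None).
  by rewrite ffunE; case: insubP => [d|]; rewrite inE ?negbK => // /negbTE ->.
have extD h (d : D) : ext h (val d) = Some (h d) by rewrite ffunE valK.
have ext_inj : injective ext.
  by move=> h h' hh'; apply/ffunP => d; apply: Some_inj; rewrite -!extD hh'.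
rewrite -[n in (n ^_ _)%N]card_ord -card_inj_ffuns -(card_imset _ ext_inj).
apply/subset_leq_card/fintype.subsetP => _ /imsetP[h + ->].
rewrite !inE => /injectiveP h_inj.
apply/andP; split; last by apply/eqP/setP => u; rewrite inE -extS.
apply/and3P; split.
- by have /card_gt0P[u] := S0; rewrite (extS h) => ?; apply/existsP; exists u.
- have : (0 < #|~: S|)%N by rewrite cardsCs finset.setCK subn_gt0.
  by case/card_gt0P => u; rewrite inE (extS h) => ?; apply/existsP; exists u.
- apply/forallP => u; apply/forallP => v; apply/implyP; rewrite !ffunE.
  case: insubP => [d _ <-|//].
  by case: insubP => [d' _ <- /= /eqP[/h_inj ->]|].
Qed.

Section RandomColouring.
Variables (R : realFieldType) (n : nat) (a : R).

Definition colour_weight (o : option 'I_n) : R :=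
  if o is None then 1 - n%:R * a else a.

(* The probability that [r] independently coloured vertices form an edge. *)
Definition edge_prob (r : nat) : R :=
  (r`!)%:R * \sum_(1 <= i < r) 'C(n, r - i)%:R *
    ((1 - n%:R * a) ^+ i / (i`!)%:R) * a ^+ (r - i).

Lemma sum_colour_weight : \sum_o colour_weight o = 1.
Proof.
rewrite (bigD1 None) //= (reindex_omap Some id) /=; last by case.
rewrite (eq_bigl xpredT) => [|j]; last by rewrite eqxx.
by rewrite sumr_const card_ord -[a *+ n]mulr_natl subrK.
Qed.

Hypotheses (a_ge0 : 0 <= a) (na_le1 : n%:R * a <= 1).

Lemma colour_weight_ge0 o : 0 <= colour_weight o.
Proof. by case: o => //=; rewrite subr_ge0. Qed.

(** Rainbow colourings are sorted by their uncoloured set [S]; all those with the same [S] have the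
    same weight, and [card_rainbow] bounds their number from below. *)
Lemma edge_prob_le (U : finType) :
  edge_prob #|U| <= \sum_(g : {ffun U -> option 'I_n})
    (\prod_u colour_weight (g u)) * (rainbow g)%:R.
Proof.
pose r := #|U|; pose w0 := 1 - n%:R * a.
pose None_set (g : {ffun U -> option 'I_n}) := [set u | g u == None]%SET.
pose F i := (n ^_ (r - i))%:R * (w0 ^+ i * a ^+ (r - i)).
have -> : edge_prob r = \sum_(S : {set U} | (0 < #|S| < r)%N) F #|S|.
  transitivity (\sum_(1 <= i < r) \sum_(S : {set U} | #|S| == i) F i).
    rewrite /edge_prob big_distrr /=; apply: eq_big_nat => i /andP[_ ir].
    (* The coefficients agree because [r! / i! * 'C(n, r - i) = 'C(r, i) * n ^_ (r - i)]. *)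
    rewrite sumr_const -cardsE card_draws -mulr_natl /F -/w0 -bin_ffact.
    rewrite -(bin_fact (ltnW ir)) !natrM.
    by field; rewrite pnatr_eq0 -lt0n fact_gt0.
  rewrite (exchange_big_dep xpredT) //= [RHS]big_mkcond; apply: eq_bigr => S _.
  under eq_bigl => i do rewrite eq_sym.
  by rewrite big_nat1_eq.
under [leRHS]eq_bigr => g _ do rewrite mulr_natr mulrb.
rewrite -[leRHS]big_mkcond /=.
rewrite [leRHS](partition_big None_set (fun S => 0 < #|S| < r)%N) /=; last first.
  move=> g /and3P[/existsP[u gu] /existsP[v gv] _]; apply/andP; split.
    by apply/card_gt0P; exists u; rewrite inE.
  rewrite /r -(cardsT U); apply/proper_card/properP.
  split; first exact: finset.subsetT.
  by exists v; rewrite inE.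
apply: ler_sum => S SU.
rewrite (eq_bigr (fun=> w0 ^+ #|S| * a ^+ (r - #|S|))) => [|g /andP[_ /eqP gS]].
  rewrite sumr_const -mulr_natl ler_wpM2r ?mulr_ge0 ?exprn_ge0 ?subr_ge0//.
  by rewrite ler_nat (leq_trans (card_rainbow n SU))// cardsE.
rewrite (bigID (mem S)) /=; congr (_ * _).
  by rewrite -prodr_const; apply: eq_bigr => u; rewrite -gS inE => /eqP ->.
have -> : (r - #|S| = #|~: S|)%N by rewrite [RHS]cardsCs finset.setCK.
rewrite -prodr_const; apply: eq_big => u; first by rewrite inE.
by rewrite -gS !inE; case: (g u).
Qed.

(** No good colouring has to be chosen: every [blowup c] has at most [ex r M H] edges, hence so does
    their weighted mean, which is computed by linearity. *)
Lemma ex_ge_edge_prob (r M : nat) (T : finType) (H : {set {set T}})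
    (blowup := fun c : {ffun 'I_M -> option 'I_n} =>
      [set e : {set 'I_M} | (#|e| == r) &&
        rainbow [ffun u : {v | v \in e} => c (val u)]]%SET) :
  (forall c, ~~ contains_copy H (blowup c)) ->
  edge_prob r * 'C(M, r)%:R <= (ex r M H)%:R.
Proof.
move=> Hfree.
pose P (c : {ffun 'I_M -> option 'I_n}) := \prod_v colour_weight (c v).
have P1 : \sum_c P c = 1.
  rewrite -(bigA_distr_bigA (fun=> colour_weight)) big1 // => v _.
  exact: sum_colour_weight.
have -> : (ex r M H)%:R = \sum_c P c * (ex r M H)%:R.
  by rewrite -big_distrl /= P1 mul1r.
apply: (@le_trans _ _ (\sum_c P c * #|blowup c|%:R)); last first.
  apply: ler_sum => c _; apply: ler_wpM2l.
    by apply: prodr_ge0 => v _; exact: colour_weight_ge0.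
  rewrite ler_nat leq_card_ex//; apply/forall_inP => e.
  by rewrite inE => /andP[].
under eq_bigr => c _ do rewrite -sum1dep_card big_mkcondr /= natr_sum big_distrr.
rewrite exchange_big /= -[M in 'C(M, r)]card_ord -card_draws.
rewrite mulr_natr -sumr_const.
under [leLHS]eq_bigl do rewrite inE.
apply: ler_sum => e /eqP er.
(* For a fixed [r]-set [e], the weight of the colourings that make it an edge is computed on the
   vertices of [e] alone. *)
rewrite -er -[#|e|]card_sig; apply: le_trans (edge_prob_le _) _.
rewrite -(sum_prod_marginal (fun g => (rainbow g)%:R) sum_colour_weight val_inj).
by apply: ler_sum => c _; rewrite lexx.
Qed.
End RandomColouring.

(** * Points and lines of projective space *)

Section PG_points.
Variables (F : finFieldType) (m : nat).
Local Notation V := 'rV[F]_m.+1.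
Local Notation point := (PG_point F m).

(** The sum of the two subspaces has dimension 2: a one-dimensional intersection would equal both of
    them. *)
Lemma line_through (p p' : point) : p != p' ->
  exists2 l, l \in PG F m & (p \in l) && (p' \in l).
Proof.
move=> pp'; exists [set x : point | (val x <= val p + val p')%VS]%SET; last first.
  by rewrite !inE addvSl addvSr.
apply/imsetP; exists (val p + val p')%VS => //; rewrite inE.
have p1 := eqP (valP p); have p'1 := eqP (valP p').
rewrite dimv_disjoint_sum ?p1 ?p'1//; apply/eqP; rewrite -dimv_eq0 -leqn0 -ltnS.
have := dimvS (capvSl (val p) (val p')); rewrite p1 leq_eqVlt => /predU1P[d1|//].
case/negP: pp'.
have e1 : (val p :&: val p' = val p)%VS.
  by apply/eqP; rewrite eqEdim capvSl p1 d1.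
have e2 : (val p :&: val p' = val p')%VS.
  by apply/eqP; rewrite eqEdim capvSr p'1 d1.
by rewrite -val_eqE -e1 e2.
Qed.

(** Every nonzero vector is a nonzero multiple of the vector picked on the line it spans, so
    [c ^ m.+1 - 1] is at most [c - 1] times the number of points. *)
Lemma card_PG_point : (\sum_(j < m.+1) #|F| ^ j <= #|{: point}|)%N.
Proof.
pose c := #|F|; have c1 : (1 < c)%N by exact: card_finNzRing_gt1.
rewrite -(@leq_pmul2l c.-1) ?ltn_predRL// -predn_exp.
have -> : (c.-1 = #|[set~ (0 : F)]|)%SET by rewrite cardsC1.
rewrite -cardsT -cardsX.
have -> : ((c ^ m.+1).-1 = #|[set~ (0 : V)]|)%SET.
  by rewrite cardsC1 card_mx mul1n.
pose h (z : F * point) : V := z.1 *: vpick (val z.2).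
apply: leq_trans (leq_imset_card h _); apply/subset_leq_card/fintype.subsetP => v.
rewrite !inE => v0.
have pv : \dim <[v]>%VS == 1%N by rewrite dim_vline v0.
pose p : point := Sub <[v]>%VS pv.
have pick0 : vpick (val p) != 0 by rewrite vpick0 -dimv_eq0 (eqP pv).
have /vlineP[a va] : v \in <[vpick (val p)]>%VS.
  suff -> : <[vpick (val p)]>%VS = <[v]>%VS by exact: memv_line.
  apply/eqP; rewrite eqEdim dim_vline pick0 (eqP pv) leqnn andbT.
  by rewrite -memvE memv_pick.
apply/imsetP; exists (a, p) => //; rewrite !inE andbT.
by apply: contraNneq v0 => /= a0; rewrite va a0 scale0r.
Qed.

End PG_points.

Lemma blowup_PG_free (F : finFieldType) (m n k : nat) (T : finType)
    (c : {ffun T -> option 'I_n}) :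
  (forall B : {set PG_point F m}, blocking_set B -> (#|B| <= k)%N) ->
  (n + k < #|{: PG_point F m}|)%N ->
  ~~ contains_copy (PG F m)
       [set e : {set T} | (#|e| == #|F|.+1) &&
         rainbow [ffun u : {v | v \in e} => c (val u)]]%SET.
Proof.
(* By contraposition: a copy leaves room for at most [k] uncoloured and [n] coloured points. *)
move=> max_k; apply: contraTN.
move=> /existsP[f /andP[/injectiveP f_inj /forall_inP fl]].
have image_line l : l \in PG F m -> [/\ #|l| = #|F|.+1,
    exists2 p, p \in l & c (f p) = None, exists2 p, p \in l & c (f p) <> None &
    {in l &, forall p p', c (f p) <> None -> c (f p) = c (f p') -> p = p'}].
  move=> /fl; rewrite inE card_imset// => /and4P[/eqP lq].
  move=> /existsP[u]; rewrite ffunE; have /imsetP[p pl ->] := valP u => /eqP cp.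
  move=> /existsP[v]; rewrite ffunE; have /imsetP[p' p'l ->] := valP v.
  move=> /eqP cp'.
  move=> /forallP inj; split => //; [by exists p|by exists p'|].
  move=> x y xl yl cx cxy.
  have fx : f x \in [set f p | p in l]%SET by exact: imset_f.
  have fy : f y \in [set f p | p in l]%SET by exact: imset_f.
  have /forallP/(_ (Sub (f y) fy))/implyP := inj (Sub (f x) fx).
  rewrite !ffunE !SubK cxy eqxx andbT -cxy => /(_ (introN eqP cx)) /eqP[].
  exact: f_inj.
pose B := [set p | c (f p) == None]%SET.
have B_blocking : blocking_set B.
  apply/forall_inP => l /image_line[lq [p pl cp] [p' p'l cp'] _].
  apply/andP; split; first by apply/card_gt0P; exists p; rewrite !inE cp eqxx.
  rewrite -ltnS -lq; apply/proper_card/properP.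
  split; first exact: finset.subsetIr.
  by exists p' => //; rewrite !inE p'l andbT; apply/eqP.
have g_inj : {in ~: B &, injective (fun p => c (f p))}%SET.
  move=> p p'; rewrite !inE => /eqP cp _ cpp'; apply/eqP/negPn/negP => pp'.
  have [l /image_line[_ _ _ inj] /andP[pl p'l]] := line_through pp'.
  by case/eqP: pp'; exact: inj.
have : (#|~: B| <= n)%SET%N.
  have <- : #|[set~ (None : option 'I_n)]%SET| = n.
    by rewrite cardsC1 card_option card_ord.
  rewrite -(card_in_imset g_inj).
  apply/subset_leq_card/fintype.subsetP => _ /imsetP[p + ->].
  by rewrite !inE.
move=> Bn; rewrite -leqNgt -(cardsC B) addnC leq_add// max_k //.
Qed.

(** * Maximizing over the colour probability *)

Lemma continuous_edge_prob (R : realType) (n r : nat) :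
  continuous (fun a : R => edge_prob n a r).
Proof.
pose p : {poly R} := (r`!)%:R *: \sum_(1 <= i < r) 'C(n, r - i)%:R *:
  ((i`!)%:R^-1 *: (1 - n%:R *: 'X) ^+ i) * 'X^(r - i).
have -> : (fun a => edge_prob n a r) = horner p; last exact: continuous_horner.
apply/funext => a; rewrite /edge_prob /p hornerZ horner_sum; congr (_ * _).
by apply: eq_bigr => i _; rewrite !hornerE; congr (_ * _); exact: mulrAC.
Qed.

Lemma edge_prob0 (R : realFieldType) (n r : nat) : edge_prob n (0 : R) r = 0.
Proof.
rewrite /edge_prob big_nat_cond big1 ?mulr0// => i /andP[/andP[_ ir] _].
by rewrite expr0n subn_eq0 leqNgt ir mulr0.
Qed.

(* F ranges over all finite fields, so q ranges over all prime powers.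
   Blocking sets are never the whole space minus at most one point, so k < N
   and the truncated subtraction N - k is an ordinary one. *)
Theorem theorem1p2 (R : realType) (F : finFieldType) (q m k : nat)
    (hq : #|F| = q) (hm : (2 <= m)%N) (hk : max_blocking_size F m k) :
  let N := (\sum_(1 <= j < m.+1) q ^ j)%N in
  exists2 M : R,
    is_maximum
      [set ((q.+1)`!)%:R *
           \sum_(1 <= i < q.+1)
              'C(N - k, q.+1 - i)%:R
              * ((1 - (N - k)%:R * alpha) ^+ i / (i`!)%:R)
              * alpha ^+ (q - i + 1)
      | alpha in [set alpha : R | 0 <= alpha <= 1 / (N - k)%:R]] M
    & M <= turan_density R q.+1 (PG F m).
Proof.
move=> N; set n := (N - k)%N.
have fE a : ((q.+1)`!)%:R * \sum_(1 <= i < q.+1) 'C(n, q.+1 - i)%:R *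
    ((1 - n%:R * a) ^+ i / (i`!)%:R) * a ^+ (q - i + 1) = edge_prob n a q.+1.
  congr (_ * _); apply: eq_big_nat => i /andP[_ iq].
  by rewrite addn1 -subSn.
(* Being polynomial in [a], the expression attains its maximum on the compact interval. *)
have [||a] := @EVT_max R (fun a => edge_prob n a q.+1) 0 (1 / n%:R).
- by rewrite divr_ge0.
- by apply: continuous_subspaceT => x; exact: continuous_edge_prob.
rewrite in_itv /= => /andP[a0 a_le] a_max.
exists (edge_prob n a q.+1).
  split; first by exists a; [rewrite /= a0 | exact: fE].
  by move=> _ [b b_in <-]; rewrite fE a_max// in_itv.
apply: turan_density_ge => M qM.
(* At [a = 0] the bound is trivial. This covers [n = 0], where [1 / 0 = 0] shrinks the interval to a
   point. *)
have [->|a_neq0] := eqVneq a 0; first by rewrite edge_prob0 mul0r.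
have n0 : (0 < n)%N.
  rewrite lt0n; apply: contraNneq a_neq0 => n0.
  by rewrite eq_le a0 (le_trans a_le)// n0 invr0 mulr0.
apply: ex_ge_edge_prob => //.
  by rewrite mulrC -ler_pdivlMr ?ltr0n.
move=> c; rewrite -hq; apply: (@blowup_PG_free _ _ _ k); first exact: hk.2.
apply: leq_trans (card_PG_point F m); rewrite hq.
(* The term [q ^ 0], absent from [N], makes the inequality strict: [n + k = N] because [0 < n]. *)
rewrite -(big_mkord xpredT (fun j => q ^ j)%N) big_ltn// expn0 add1n ltnS.
by rewrite subnK// ltnW// -subn_gt0.
Qed.
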